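(* (In ZFC set theory.) For a graph $G$ the following are equivalent: (a) $G$ is a generalized Cayley graph of a quasigroup; (b) $G$ is a generalized Cayley graph of a quasigroup with a left identity; (c) $G$ is simple, deterministic, co-deterministic, co-regular, source-complete and target-complete. Likewise, the following are equivalent: (a') $G$ is a generalized Cayley graph of a quasigroup with a right identity; (b') $G$ is a generalized Cayley graph of a quasigroup with an identity; (c') $G$ is simple, deterministic, co-deterministic, co-regular, source-complete, target-complete and loop-complete.
   Context: A graph is a non-empty set $G\subseteq V\times A\times V$ of labeled edges $s\xrightarrow{a}_G t$; $s\to_G t$ means such an edge exists for some $a$; $V_G$ is the set of vertices occurring in edges, $A_G$ the set of labels. A graph is a generalized Cayley graph of a magma $(M,\cdot)$ if it equals $\mathcal{C}\langle M,Q\rangle=\{(p,\langle q\rangle,p\cdot q): p\in M,\ q\in Q\}$ for some $Q\subseteq M$ and injective $\langle\,\rangle:Q\to A$. A quasigroup is a magma in which for all $p,q$ there is a unique $r$ with $p\cdot r=q$ and a unique $s$ with $s\cdot p=q$. Left identity: $e\cdot p=p$ for all $p$; right identity: $p\cdot e=p$ for all $p$; identity: both. $G$ is simple if no two edges share source and target; deterministic if $r\xrightarrow{a}s$, $r\xrightarrow{a}t$ imply $s=t$; co-deterministic if $s\xrightarrow{a}r$, $t\xrightarrow{a}r$ imply $s=t$; source-complete if for all $s\in V_G$, $a\in A_G$ there is $t$ with $s\xrightarrow{a}_G t$; target-complete if for all $t\in V_G$, $a\in A_G$ there is $s$ with $s\xrightarrow{a}_G t$; loop-complete if whenever some vertex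 has an $a$-labeled loop, every vertex has an $a$-labeled loop. Let $S=\{(s,t)\in V_G\times V_G: \text{no edge } s\to_G t\}$; $G$ is co-regular if $S$ is a regular relation on $V_G$, meaning that for all $s\in V_G$, $|S(s)|=|S^{-1}(s)|=\Delta_S$, where $S(s)=\{t:(s,t)\in S\}$, $S^{-1}(s)=\{t:(t,s)\in S\}$ and $\Delta_S$ is the supremum of all these cardinals. *)

(* Defs.v *)
From mathcomp Require Import all_boot.
From mathcomp Require Import boolp classical_sets functions cardinality.

Set Implicit Arguments.
Unset Strict Implicit.
Unset Printing Implicit Defensive.

Local Open Scope classical_set_scope.
Local Open Scope card_scope.

Section Magma.
Variables (M : Type) (op : M -> M -> M).

Definition quasigroup : Prop :=
  (forall p q, exists! r, op p r = q) /\ (forall p q, exists! s, op s p = q).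

Definition left_identity (e : M) : Prop := forall p, op e p = p.

Definition right_identity (e : M) : Prop := forall p, op p e = p.

Definition identity (e : M) : Prop := left_identity e /\ right_identity e.

End Magma.

(* A graph is a set of triples (source, label, target); its non-emptiness is
   a hypothesis of the theorem. *)
Section Graph.
Variables (V A : Type).
Implicit Types (G : set (V * A * V)).

Definition vertices G : set V :=
  [set v | exists a w, G (v, a, w) \/ G (w, a, v)].

Definition labels G : set A := [set a | exists s t, G (s, a, t)].

Definition edge G (s t : V) : Prop := exists a, G (s, a, t).

Definition simple G : Prop :=
  forall s a b t, G (s, a, t) -> G (s, b, t) -> a = b.

Definition deterministic G : Prop :=
  forall r a s t, G (r, a, s) -> G (r, a, t) -> s = t.

Definition codeterministic G : Prop :=
  forall r a s t, G (s, a, r) -> G (t, a, r) -> s = t.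

Definition source_complete G : Prop :=
  forall s a, vertices G s -> labels G a -> exists t, G (s, a, t).

Definition target_complete G : Prop :=
  forall t a, vertices G t -> labels G a -> exists s, G (s, a, t).

Definition loop_complete G : Prop :=
  forall a, (exists v, G (v, a, v)) -> forall v, vertices G v -> G (v, a, v).

(* Cardinals are represented by sets up to equipotence, so the supremum of a
   family of cardinals is an equipotence class: D represents it when it is an
   upper bound that embeds into every other upper bound. *)
Definition is_card_sup (F : set (set V)) (U : Type) (D : set U) : Prop :=
  (forall X, F X -> X #<= D) /\
  (forall (W : Type) (E : set W), (forall X, F X -> X #<= E) -> D #<= E).

(* R(s) is xsection R s and R^{-1}(s) is ysection R s; D has cardinal
   Delta_R. *)
Definition regular_on (X : set V) (R : set (V * V)) : Prop :=
  exists (U : Type) (D : set U),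
    is_card_sup ((xsection R @` X) `|` (ysection R @` X)) D /\
    (forall s, X s -> xsection R s #= D /\ ysection R s #= D).

Definition nonedges G : set (V * V) :=
  [set st | [/\ vertices G st.1, vertices G st.2 & ~ edge G st.1 st.2]].

Definition coregular G : Prop := regular_on (vertices G) (nonedges G).

(* The magma is carried by a subset M of V, since its elements are to be
   the vertices of the graph; M, and Q, are used as types through the coercion
   set_type, so that op is only defined on M and lab only on Q. *)
Definition cayley_graph (M : set V) (op : M -> M -> M) (Q : set M)
    (lab : Q -> A) : set (V * A * V) :=
  [set e | exists (p : M) (q : Q), e = (val p, lab q, val (op p (val q)))].

Definition gen_cayley_graph_of (M : set V) (op : M -> M -> M) G : Prop :=
  exists (Q : set M) (lab : Q -> A), injective lab /\ G = cayley_graph op lab.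

End Graph.

(* Main.v *)
Require Import Defs.
From mathcomp Require Import all_boot.
From mathcomp Require Import boolp classical_sets functions cardinality.
From mathcomp Require Import wochoice filter.

Set Implicit Arguments.
Unset Strict Implicit.
Unset Printing Implicit Defensive.

Local Open Scope classical_set_scope.

(* Fix a vertex r. Colour all pairs of vertices so that every colour class is
   the graph of a permutation, the edges of G being coloured by their labels;
   then p * q := the vertex t such that (p, t) and (r, q) have the same colour
   is a quasigroup with left identity r whose Cayley graph is G, and r is a
   right identity as soon as the diagonal is monochromatic. So everything
   reduces to splitting the regular relation of non-edges (if G has no loop,
   its diagonal is taken out first and made a class of its own) into
   permutations. In finite degree n, finite subgraphs are properly coloured
   with n colours by Kempe chains, and an ultrafilter gives a proper colouring
   of the whole, which uses all n colours at every vertex. In infinite degree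
   W, a connected component has at most |W| vertices since |W x W| = |W|, and a
   greedy transfinite construction of length |W| meets the requirements
   (vertex, colour) and (edge) one at a time. *)

(* P s t c reads: the pair (s, t) of S has colour c. *)
Definition latin (T C : Type) (S : T -> T -> Prop) (P : T -> T -> C -> Prop) :=
  [/\ forall s t c, P s t c -> S s t,
      forall s t, S s t -> exists! c, P s t c,
      forall s c, exists! t, P s t c
    & forall t c, exists! s, P s t c].

(** The type [W] stands for the degree: [f] enumerates the successors of [s] without repetition. *)
Definition out_indexed (T W : Type) (S : T -> T -> Prop) :=
  forall s, exists f : W -> T, injective f /\ forall t, S s t <-> exists w, f w = t.

Definition biregular (T W : Type) (S : T -> T -> Prop) :=
  out_indexed W S /\ out_indexed W (fun t s => S s t).

(** Pairs are edges of a bipartite graph on two copies of [T], so [(x, y)] and [(y, z)] may share a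
    colour. *)
Definition proper_coloring (T C : Type) (F : set (T * T)) (k : T * T -> C) :=
  forall e e', F e -> F e' -> e.1 = e'.1 \/ e.2 = e'.2 -> k e = k e' -> e = e'.

(** * Finite degree *)

(* The two sides of the bipartite graph F are told apart by the boolean, true
   for targets. *)
Inductive kempe (T C : Type) (F : set (T * T)) (k : T * T -> C) (a b : C) (v : T)
    : bool -> T -> Prop :=
  | kempe_start : kempe F k a b v true v
  | kempe_back x y : kempe F k a b v true y -> F (x, y) -> k (x, y) = a ->
      kempe F k a b v false x
  | kempe_forth x y : kempe F k a b v false x -> F (x, y) -> k (x, y) = b ->
      kempe F k a b v true y.

(** Swapping [a] and [b] along the chain from the target [v] frees [a] at [v]. The chain enters
    sources only through edges coloured [a], so it misses [u], where [a] stays free; the new edge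
    then receives [a]. *)
Lemma kempe_extension (T : Type) (C : eqType) (F : set (T * T)) (k : T * T -> C)
    (a b : C) (u v : T) :
    proper_coloring F k -> ~ F (u, v) ->
    (forall y, F (u, y) -> k (u, y) <> a) -> (forall x, F (x, v) -> k (x, v) <> b) ->
  exists k' : T * T -> C, proper_coloring (F `|` [set (u, v)]) k'.
Proof.
move=> Fk nFuv ua vb; pose K := kempe F k a b v.
have Fsrc x y y' : F (x, y) -> F (x, y') -> k (x, y) = k (x, y') -> y = y'.
  by move=> Fxy Fxy' /Fk-/(_ Fxy Fxy' (or_introl erefl)) [].
have Ftgt x x' y : F (x, y) -> F (x', y) -> k (x, y) = k (x', y) -> x = x'.
  by move=> Fxy Fxy' /Fk-/(_ Fxy Fxy' (or_intror erefl)) [].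
have Kclosed x y : F (x, y) -> k (x, y) = a \/ k (x, y) = b -> K false x <-> K true y.
  move=> Fxy kxy; split=> Kxy; case: kxy => kxy.
  - inversion Kxy as [|x' y' Ky' Fxy' kxy'|]; subst.
    by rewrite (Fsrc _ _ _ Fxy Fxy')// kxy.
  - exact: kempe_forth Kxy Fxy kxy.
  - exact: kempe_back Kxy Fxy kxy.
  - inversion Kxy as [| |x' y' Kx' Fxy' kxy']; subst; first by case: (vb _ Fxy).
    by rewrite (Ftgt _ _ _ Fxy Fxy')// kxy.
have nKu : ~ K false u 
  by move=> Ku; inversion Ku as [|x y _ Fuy kuy|]; exact: ua Fuy kuy.
pose sw c := if c == a then b else if c == b then a else c.
have swK : involutive sw.
  move=> c; rewrite /sw; have [->|ca] := eqVneq c a.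
    by case: eqVneq => [->|]//; rewrite eqxx.
  by have [->|/negPf cb] := eqVneq c b; rewrite ?eqxx// (negPf ca) cb.
have swid c : sw c <> c -> c = a \/ c = b.
  rewrite /sw; have [|ca] := eqVneq c a; first by left.
  by have [|cb] := eqVneq c b; first by right.
(* Testing the target alone suffices: by [Kclosed], an edge coloured [a] or [b] has both ends on the
   chain or neither. *)
pose k1 e := if pselect (K true e.2) then sw (k e) else k e.
pose k' e := if pselect (e = (u, v)) then a else k1 e.
have k'F e : F e -> k' e = k1 e.
  by rewrite /k' => Fe; case: pselect => // euv; case: nFuv; rewrite -euv.
have k'uv : k' (u, v) = a by rewrite /k'; case: pselect.
(* The only delicate conflict: two edges with the same source, just one of which has its target on
   the chain. *)
have split_src x y y' : F (x, y) -> F (x, y') -> K true y -> ~ K true y' ->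
    sw (k (x, y)) = k (x, y') -> y = y'.
  move=> Fy Fy' Ky nKy' kk; have [kxy|/swid kxy] := EM (sw (k (x, y)) = k (x, y)).
    by apply: (Fsrc _ _ _ Fy Fy'); rewrite -kk kxy.
  have kxy' : k (x, y') = a \/ k (x, y') = b.
    rewrite -kk; case: kxy => ->; rewrite /sw eqxx; first by right.
    by case: eqVneq => _; auto.
  by case: nKy'; apply/(Kclosed _ _ Fy' kxy')/(Kclosed _ _ Fy kxy).
have k1proper : proper_coloring F k1.
  move=> [x y] [x' y'] Fe Fe' /= [xx|yy].
    subst x'; rewrite /k1 /=; case: pselect => Ky; case: pselect => Ky'.
    - by move=> /(inv_inj swK) /(Fsrc _ _ _ Fe Fe') ->.
    - by move=> /(split_src _ _ _ Fe Fe' Ky Ky') ->.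
    - by move=> /esym /(split_src _ _ _ Fe' Fe Ky' Ky) ->.
    - by move=> /(Fsrc _ _ _ Fe Fe') ->.
  subst y'; rewrite /k1 /=; case: pselect => Ky.
    by move=> /(inv_inj swK) /(Ftgt _ _ _ Fe Fe') ->.
  by move=> /(Ftgt _ _ _ Fe Fe') ->.
have k1uv e : F e -> e.1 = u \/ e.2 = v -> k1 e <> a.
  case: e => [x y] Fe /= xy; rewrite /k1 /=; case: pselect => Ky; move=> /= ka.
    have kb : k (x, y) = b by rewrite -[LHS]swK ka /sw eqxx.
    case: xy => [xu|yv]; last by rewrite yv in Fe kb; exact: vb Fe kb.
    by rewrite xu in Fe kb; apply: nKu; apply/(Kclosed _ _ Fe (or_intror kb)).
  case: xy => [xu|yv]; first by rewrite xu in Fe ka; exact: ua Fe ka.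
  by apply: Ky; rewrite yv; exact: kempe_start.
exists k' => e e' [Fe|->] [Fe'|->] //.
- by rewrite !k'F//; exact: k1proper.
- by rewrite k'uv k'F// => euv /(k1uv _ Fe euv).
- by rewrite k'uv k'F// => euv /esym /k1uv -/(_ Fe') []; case: euv; auto.
Qed.

(** Pigeonhole: if every colour occurred on [D], choosing an index for each colour would inject
    ['I_n] into itself, hence reach [w0]. *)
Lemma missing_color (T : Type) n (f : 'I_n -> T) (D : set T) (k : T -> 'I_n) w0 :
    (forall y, D y -> exists w, f w = y) -> ~ D (f w0) ->
  exists a, forall y, D y -> k y <> a.
Proof.
move=> Df nDv; apply: contrapT => /forallNP na.
have /choice[h hP] (a : 'I_n) : exists w, D (f w) /\ k (f w) = a.
  have /existsNP[y /not_implyP[Dy /contrapT ky]] := na a.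
  by have [w fw] := Df _ Dy; exists w; rewrite fw.
have hinj : injective h by move=> a a' hh; rewrite -(hP a).2 hh (hP a').2.
have [h' _ hh'] := injF_bij hinj.
by apply: nDv; rewrite -(hh' w0); exact: (hP _).1.
Qed.

(** Edges are added one at a time. A new edge occupies one of the [n.+1] places at each of its ends,
    so the edges coloured before leave a colour free there. *)
Lemma finite_edge_coloring (T : Type) n (S : T -> T -> Prop)
    (r : seq {classic T * T}) : biregular 'I_n.+1 S ->
  exists k : T * T -> 'I_n.+1, proper_coloring [set e | e \in r /\ S e.1 e.2] k.
Proof.
move=> [Sout Sin]; elim: r => [|[u v] r [k kP]].
  by exists (fun=> ord0) => e e' [].
have [Suv|nSuv] := EM (S u v /\ (u, v) \notin r); last first.
  exists k => e e' [re Se] [re' Se']; apply: kP; split=> //.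
    move: re; rewrite inE => /orP[/eqP ee|//]; subst.
    by apply: contrapT => /negP nr; apply: nSuv.
  move: re'; rewrite inE => /orP[/eqP ee|//]; subst.
  by apply: contrapT => /negP nr; apply: nSuv.
case: Suv => Suv nr.
pose F := [set e : T * T | e \in r /\ S e.1 e.2].
have nF : ~ F (u, v) by move=> [] /=; rewrite (negPf nr).
have [f [_ fP]] := Sout u; have [w fw] := (fP v).1 Suv.
have [|| a ua] := @missing_color _ _ f (fun y => F (u, y)) (fun y => k (u, y)) w.
- by move=> y [_ /fP].
- by rewrite fw.
have [g [_ gP]] := Sin v; have [w' gw] := (gP u).1 Suv.
have [|| b vb] := @missing_color _ _ g (fun x => F (x, v)) (fun x => k (x, v)) w'.
- by move=> y [_ /gP].
- by rewrite gw.
have [k' k'P] := kempe_extension kP nF ua vb.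
exists k' => e e' [re Se] [re' Se']; apply: k'P.
  by move: re; rewrite inE => /orP[/eqP|]; [right|left].
by move: re'; rewrite inE => /orP[/eqP|]; [right|left].
Qed.

(** The colouring is a limit along an ultrafilter [U] containing every set [A r]. Properness
    concerns two edges at a time, so it passes to the limit. *)
Lemma proper_coloring_compactness (T : Type) n (S : set (T * T)) :
    (forall r : seq {classic T * T}, exists k : T * T -> 'I_n,
      proper_coloring [set e | e \in r /\ S e] k) ->
  exists k : T * T -> 'I_n, proper_coloring S k.
Proof.
move=> fin.
pose A (r : seq {classic T * T}) :=
  [set k : T * T -> 'I_n | proper_coloring [set e | e \in r /\ S e] k].
have Aproper : ProperFilter (filter_from setT A).
  apply: filter_from_proper => [|r _]; last exact: fin.
  apply: filter_from_filter; first by exists [::].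
  move=> r r' _ _; exists (r ++ r') => // k kP.
  by split=> e e' [re Se] [re' Se']; apply: kP; rewrite /= mem_cat ?re ?re' ?orbT.
have [U [Uultra AU]] := ultraFilterLemma Aproper.
have UA r : U (A r) by apply: AU; exists r.
(* There are finitely many colours: if each were avoided at [e] by [U]-almost all [k], some [k]
   would avoid them all. *)
have /choice[col colP] e : exists c, U [set k : T * T -> 'I_n | k e = c].
  apply: contrapT => /forallNP nU.
  have /filter_ex[k /(_ (k e))//] : U [set k | forall c, k e <> c].
  apply: filter_forall => c.
  by have [/nU|] := in_ultra_setVsetC [set k : T * T -> 'I_n | k e = c] Uultra.
exists col => e e' Se Se' ee cc.
have /filter_ex[k [[kP ke] ke']] :
    U (A [:: e; e'] `&` [set k | k e = col e] `&` [set k | k e' = col e']).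
  by apply: filterI (colP e'); exact: filterI (UA _) (colP e).
apply: kP => //; first by rewrite /= inE eqxx.
- by rewrite /= !inE eqxx orbT.
- by rewrite ke ke'.
Qed.

Lemma latin_finite (T : Type) n (S : T -> T -> Prop) : biregular 'I_n S ->
  exists P : T -> T -> 'I_n -> Prop, latin S P.
Proof.
case: n => [|n] Sreg.
  exists (fun _ _ _ => False); split=> [//|s t|s []//|t []//].
  by have [f [_ fP]] := Sreg.1 s => /fP [[]].
have [k kP] := @proper_coloring_compactness T n.+1 (fun e => S e.1 e.2)
  (fun r => finite_edge_coloring r Sreg).
exists (fun s t c => S s t /\ k (s, t) = c); split.
- by move=> s t c [].
- by move=> s t Sst; exists (k (s, t)); split=> // c [].
(* The [n.+1] edges at [s] have distinct colours, so every colour occurs. *)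
- move=> s c; have [f [finj fP]] := Sreg.1 s.
  have Sf w : S s (f w) by apply/fP; exists w.
  have kfinj : injective (fun w => k (s, f w)).
    by move=> w w' /kP-/(_ (Sf w) (Sf w') (or_introl erefl)) [/finj].
  have [h _ hh] := injF_bij kfinj.
  exists (f (h c)); split=> [|t [Sst kc]]; first by split.
  have := hh c; rewrite -{2}kc => /kP-/(_ (Sf _) Sst (or_introl erefl)).
  by case.
- move=> t c; have [f [finj fP]] := Sreg.2 t.
  have Sf w : S (f w) t by apply/fP; exists w.
  have kfinj : injective (fun w => k (f w, t)).
    by move=> w w' /kP-/(_ (Sf w) (Sf w') (or_intror erefl)) [/finj].
  have [h _ hh] := injF_bij kfinj.
  exists (f (h c)); split=> [|s [Sst kc]]; first by split.
  have := hh c; rewrite -{2}kc => /kP-/(_ (Sf _) Sst (or_intror erefl)).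
  by case.
Qed.

(** * Infinite degree *)

(** Zorn on partial injections: a maximal one missing both some [x0] and some [y0] could be extended
    by [(x0, y0)]. *)
Lemma injection_total (T U : Type) :
  (exists f : T -> U, injective f) \/ (exists f : U -> T, injective f).
Proof.
pose P (R : set (T * U)) :=
  forall x x' y y', R (x, y) -> R (x', y') -> x = x' <-> y = y'.
have [|R [PR Rmax]] := @Zorn_bigcup _ P.
  move=> F FP Ftot x x' y y' [X FX Xxy] [Y FY Yxy].
  have [XY|YX] := Ftot _ _ FX FY.
  - exact: (FP _ FY _ _ _ _ (XY _ Xxy) Yxy).
  - exact: (FP _ FX _ _ _ _ Xxy (YX _ Yxy)).
have [/choice[f Rf]|/existsNP[x0 /forallNP Rx0]] :=
    pselect (forall x, exists y, R (x, y)).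
  by left; exists f => x x' ff; apply/(PR _ _ _ _ (Rf x) (Rf x')).
have [/choice[f Rf]|/existsNP[y0 /forallNP Ry0]] :=
    pselect (forall y, exists x, R (x, y)).
  by right; exists f => y y' ff; apply/(PR _ _ _ _ (Rf y) (Rf y')).
exfalso; apply: (Rmax (R `|` [set (x0, y0)])).
  by split=> [p|/(_ (x0, y0) (or_intror erefl))]; [left|exact: Rx0].
move=> x x' y y' [Rxy|[-> ->]] [Rxy'|[-> ->]] //.
- exact: PR.
- by split=> e; subst; [case: (Rx0 _ Rxy)|case: (Ry0 _ Rxy)].
- by split=> e; subst; [case: (Rx0 _ Rxy')|case: (Ry0 _ Rxy')].
Qed.

Lemma strict_well_order (W : Type) : exists lt : W -> W -> Prop,
  well_founded lt /\ forall x y, x <> y -> lt x y \/ lt y x.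
Proof.
have [R woR] := well_ordering_principle {classic W}.
have Rmin (A : set W) : A !=set0 -> exists2 z, A z & forall x, A x -> R z x.
  move=> [a Aa]; have [|z [[Az zmin] _]] := woR (fun x : {classic W} => `[< A x >]).
    by exists a; apply/asboolP.
  by exists z => [|x Ax]; [exact/asboolP|apply: zmin; exact/asboolP].
(* Antisymmetry comes from the uniqueness of the least element of a two-point set. *)
have Ranti (x y : W) : R x y -> R y x -> x = y.
  move=> Rxy Ryx.
  have Rxx z : R z z by have [|_ -> ->//] := Rmin [set z]; exists z.
  have [|z [_ zuniq]] := woR (fun z : {classic W} => `[< z = x \/ z = y >]).
    by exists x; apply/asboolP; left.
  have -> : x = z.
    by apply/esym/zuniq; split=> [|t /asboolP[->|->]//]; apply/asboolP; left.
  by apply: zuniq; split=> [|t /asboolP[->|->]//]; apply/asboolP; right.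
exists (fun x y => R x y /\ x <> y); split=> [x|x y xy].
  apply: contrapT => nAx.
  have [|z nAz zmin] := Rmin [set x | ~ Acc (fun x y => R x y /\ x <> y) x].
    by exists x.
  apply: nAz; constructor=> y [Ryz nyz].
  by apply: contrapT => /zmin /(Ranti _ _ Ryz).
have [|z [->|->] zmin] := Rmin [set x; y]; first by exists x; left.
- by left; split=> //; apply: zmin; right.
- by right; split=> [|/esym//]; apply: zmin; left.
Qed.

(* The order type of an initial ordinal, pulled back along an injection of W
   into its least initial segment of full cardinality. *)
Lemma initial_well_order (W : Type) : exists lt : W -> W -> Prop,
  [/\ well_founded lt, forall x y, x <> y -> lt x y \/ lt y x
    & forall b (f : W -> W), injective f -> exists x, ~ lt (f x) b].
Proof.
have [lt [wflt lt_total]] := strict_well_order W.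
have [small|] := pselect (forall b (f : W -> W), injective f ->
    exists x, ~ lt (f x) b).
  by exists lt.
move=> /existsNP[b0 nb0].
(* [b] is the least point below which [W] embeds. *)
have [b] : exists b, (exists2 f : W -> W, injective f & forall x, lt (f x) b) /\
    forall c, lt c b -> forall f : W -> W, injective f -> exists x, ~ lt (f x) c.
  elim: (wflt b0) nb0 => b _ IH nb.
  have [small|/existsNP[c /not_implyP[cb nc]]] := pselect (forall c, lt c b ->
      forall f : W -> W, injective f -> exists x, ~ lt (f x) c).
    exists b; split=> //; move/existsNP: nb => [f /not_implyP[finj nf]].
    by exists f => // x; apply: contrapT => nx; apply: nf; exists x.
  exact: (IH c).
move=> [[j jinj jb] small].
exists (fun x y => lt (j x) (j y)); split.
- move=> x; have [y jx] : exists y, j x = y by exists (j x).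
  elim: (wflt y) x jx => {}y _ IH x jx; constructor=> z; rewrite jx => zy.
  exact: IH (j z) zy z erefl.
- by move=> x y xy; apply: lt_total => /jinj.
- move=> c f finj; have [x nx] := small (j c) (jb c) (j \o f) (inj_comp jinj finj).
  by exists x.
Qed.

(** Zorn on graphs of injections from [A * A] to [A], for subsets [A] of [W]. For a maximal one,
    either the complement of [A] embeds into [A], and then so does [W], or [A] embeds into its
    complement, and the graph can be extended. *)
Lemma infinite_square (W : Type) (i : nat -> W) : injective i ->
  exists f : W * W -> W, injective f.
Proof.
move=> iinj.
pose field (R : set (W * W * W)) := [set x | exists z, R (x, x, z)].
(* The last clause makes a non-empty field infinite; it is conditional because the empty chain has
   an empty union. *)
pose P (R : set (W * W * W)) :=
  [/\ forall x y z x' y' z', R (x, y, z) -> R (x', y', z') ->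
        (x, y) = (x', y') <-> z = z',
      forall x y z, R (x, y, z) -> [/\ field R x, field R y & field R z],
      forall x y, field R x -> field R y -> exists z, R (x, y, z)
    & field R !=set0 -> forall n, field R (i n)].
have field_sub R R' : R `<=` R' -> field R `<=` field R'.
  by move=> RR' x [z /RR' ?]; exists z.
have [|R [[Rinj Rfield Rtot Rnat] Rmax]] := @Zorn_bigcup _ P.
  move=> F FP Ftot.
  have chain X Y : F X -> F Y -> exists Z, [/\ F Z, X `<=` Z & Y `<=` Z].
    move=> FX FY; have [XY|YX] := Ftot _ _ FX FY.
    - by exists Y; split.
    - by exists X; split.
  have sup X : F X -> X `<=` \bigcup_(Y in F) Y by move=> FX x; exists X.
  split.
  - move=> x y z x' y' z' [X FX Xx] [Y FY Yx].
    have [Z [FZ XZ YZ]] := chain _ _ FX FY.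
    by have [Zinj _ _ _] := FP _ FZ; exact: Zinj (XZ _ Xx) (YZ _ Yx).
  - move=> x y z [X FX /[dup] Xx].
    have [_ Xfield _ _] := FP _ FX => /Xfield[fx fy fz].
    by split; apply: (field_sub _ _ (sup _ FX)).
  - move=> x y [z [X FX Xx]] [z' [Y FY Yy]].
    have [Z [FZ XZ YZ]] := chain _ _ FX FY.
    have [_ _ Ztot _] := FP _ FZ; have [||t Zt] := Ztot x y.
    + by exists z; exact: XZ.
    + by exists z'; exact: YZ.
    + by exists t, Z.
  - move=> [x [z [X FX Xx]]] n; apply: (field_sub _ _ (sup _ FX)).
    by have [_ _ _ Xnat] := FP _ FX; apply: Xnat; exists x, z.
pose A := field R.
(* An empty [R] is not maximal: [pickle] on pairs of naturals gives such an injection on the range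
   of [i]. *)
have Ai : forall n, A (i n).
  apply: Rnat; apply: contrapT => A0.
  have R0 : R = set0.
    apply/seteqP; split=> // -[[x y] z] /Rfield[Ax _ _].
    by apply: A0; exists x.
  pose R0' := [set t | exists m n, t = (i m, i n, i (pickle (m, n)))].
  have f0 m : field R0' (i m) by exists (i (pickle (m, m))), m, m.
  apply: (Rmax R0').
    rewrite R0; split=> // /(_ (i 0, i 0, i (pickle (0, 0))))%N.
    by apply; exists 0%N, 0%N.
  split=> //.
  - move=> _ _ _ _ _ _ [m [n [-> -> ->]]] [m' [n' [-> -> ->]]]; split.
      by move=> [/iinj-> /iinj->].
    by move=> /iinj /(pcan_inj pickleK)[-> ->].
  - by move=> _ _ _ [m [n [-> -> ->]]].
  - move=> x y [_ [m [_ [-> _ _]]]] [_ [n [_ [-> _ _]]]].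
    by exists (i (pickle (m, n))), m, n.
have /choice[f Rf] (p : W * W) : exists z, A p.1 -> A p.2 -> R (p, z).
  case: p => x y /=.
  have [[Ax Ay]|nA] := pselect (A x /\ A y).
    by have [z] := Rtot _ _ Ax Ay; exists z.
  by exists x => Ax Ay; case: nA.
have finj x y x' y' : A x -> A y -> A x' -> A y' ->
    f (x, y) = f (x', y') -> (x, y) = (x', y').
  by move=> Ax Ay Ax' Ay' ff; apply/(Rinj _ _ _ _ _ _ (Rf (x, y) Ax Ay)
    (Rf (x', y') Ax' Ay')).
have Af x y : A x -> A y -> A (f (x, y)).
  by move=> Ax Ay; have [] := Rfield _ _ _ (Rf (x, y) Ax Ay).
have sval_inj (D : W -> Prop) : injective (@proj1_sig W D).
  by move=> [x Dx] [y Dy] /= xy; exact: eq_exist.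
have [[g ginj]|[h hinj]] := injection_total {x | ~ A x} {x | A x}.
  (* The tags [i 0] and [i 1] keep the images of [A] and of its complement apart. *)
  pose e x : W := match pselect (A x) with
    | left Ax => f (x, i 0%N)
    | right nAx => f (proj1_sig (g (exist _ x nAx)), i 1%N)
    end.
  have Ae x : A (e x).
    rewrite /e; case: pselect => Ax; first exact: Af.
    by apply: Af => //; exact: proj2_sig.
  have einj : injective e.
    move=> x y; rewrite /e; case: pselect => Ax; case: pselect => Ay.
    - by move=> /(finj _ _ _ _ Ax (Ai _) Ay (Ai _)) [].
    - by move=> /(finj _ _ _ _ Ax (Ai _) (proj2_sig _) (Ai _)) [_ /iinj].
    - by move=> /(finj _ _ _ _ (proj2_sig _) (Ai _) Ay (Ai _)) [_ /iinj].
    - move=> /(finj _ _ _ _ (proj2_sig _) (Ai _) (proj2_sig _) (Ai _)) [gg].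
      by case: (ginj _ _ (sval_inj _ _ _ gg)).
  exists (fun p => f (e p.1, e p.2)) => -[x y] [x' y'] /=.
  by move=> /(finj _ _ _ _ (Ae _) (Ae _) (Ae _) (Ae _)) [/einj-> /einj->].
exfalso.
have [k [nAk kinj]] : exists k : W -> W, (forall a, A a -> ~ A (k a)) /\
    forall a b, A a -> A b -> k a = k b -> a = b.
  exists (fun a => match pselect (A a) with
    | left Aa => proj1_sig (h (exist _ a Aa))
    | right _ => a end); split=> [a Aa|a b Aa Ab].
    by case: pselect => // Aa'; exact: (proj2_sig (h _)).
  case: pselect => // Aa'; case: pselect => // Ab' hh.
  by case: (hinj _ _ (sval_inj _ _ _ hh)).
(* [A] is doubled to [B] by adjoining its copy under [k]. [u] sends each point of [B] back to [A],
   and [tag] records which half each coordinate came from, so [code] injects [B * B] into [A]. *)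
pose B x := A x \/ exists2 a, A a & k a = x.
have /choice[u uP] x : exists a, B x -> A a /\ (A x /\ a = x \/ ~ A x /\ k a = x).
  have [[Ax|[a Aa ka]]|nB] := pselect (B x).
  - by exists x => _; split=> //; left.
  - by exists a => _; split=> //; right; split=> //; rewrite -ka; exact: nAk.
  - by exists x.
have Au x : B x -> A (u x) by move=> /uP[].
have uinj x y : B x -> B y -> A x = A y -> u x = u y -> x = y.
  move=> /uP[_ ux] /uP[_ uy] AA uu; move: ux uy; rewrite uu AA.
  by move=> [[Ay <-]|[nAy <-]] [[Ay' e]|[nAy' e]].
pose tag (p : W * W) := pickle (`[< A p.1 >], `[< A p.2 >]).
pose code p := f (f (u p.1, u p.2), i (tag p)).
have Acode p : B p.1 -> B p.2 -> A (code p).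
  by move=> Bx By; apply: (Af) => //; apply: Af; exact: Au.
have codeinj p q : B p.1 -> B p.2 -> B q.1 -> B q.2 -> code p = code q -> p = q.
  case: p q => [x y] [x' y'] /= Bx By Bx' By'.
  have asb Q Q' : `[< Q >] = `[< Q' >] -> Q = Q'.
    by move=> e; apply/propext; split=> /asboolP; rewrite (e, esym e) => /asboolP.
  have Auu a b : B a -> B b -> A (f (u a, u b)) by move=> *; apply: Af; exact: Au.
  move=> /(finj _ _ _ _ (Auu _ _ Bx By) (Ai _) (Auu _ _ Bx' By') (Ai _)).
  move=> [/(finj _ _ _ _ (Au _ Bx) (Au _ By) (Au _ Bx') (Au _ By')) [ux uy]].
  move=> /iinj /(pcan_inj pickleK) [/asb Ax /asb Ay].
  by rewrite (uinj _ _ Bx Bx' Ax ux) (uinj _ _ By By' Ay uy).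
(* Pairs not already in [A * A] get values in the copy [k A], which the values of [R] avoid. *)
pose new := [set t : W * W * W |
  [/\ B t.1.1, B t.1.2, ~ (A t.1.1 /\ A t.1.2) & t.2 = k (code t.1)]].
pose R' := R `|` new.
have new_tot x y : B x -> B y -> exists z, R' (x, y, z).
  move=> Bx By; have [[Ax Ay]|nA] := pselect (A x /\ A y).
    by have [z] := Rtot _ _ Ax Ay; exists z; left.
  by exists (k (code (x, y))); right.
have fieldB x : B x -> field R' x by move=> Bx; exact: new_tot.
have Bk a : A a -> B (k a) by move=> Aa; right; exists a.
have newB x y z : R' (x, y, z) -> [/\ B x, B y & B z].
  move=> [/Rfield[Ax Ay Az]|[/= Bx By _ ->]]; first by split; left.
  by split=> //; apply: Bk; exact: Acode.
apply: (Rmax R').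
  split=> [t|]; first by left.
  pose p0 := (i 0%N, k (i 0%N)) => sub.
  have /sub/Rfield[_ Ak _] : R' (p0, k (code p0)); last exact: nAk Ak.
  right; split; rewrite /p0 //=; [by left|exact: Bk|by case=> _; exact: nAk].
split.
- move=> x y z x' y' z' [Rx|[/= Bx By nA ->]] [Rx'|[/= Bx' By' nA' ->]].
  + exact: (Rinj _ _ _ _ _ _ Rx Rx').
  + have [Ax Ay Az] := Rfield _ _ _ Rx; split=> [[xx yy]|zz].
      by exfalso; apply: nA'; rewrite -xx -yy.
    by case: (nAk (code (x', y'))); [exact: Acode|rewrite -zz].
  + have [Ax Ay Az] := Rfield _ _ _ Rx'; split=> [[xx yy]|zz].
      by exfalso; apply: nA; rewrite xx yy.
    by case: (nAk (code (x, y))); [exact: Acode|rewrite zz].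
  + split=> [[-> ->]//|/kinj kk]; apply: codeinj => //.
    by apply: kk; exact: Acode.
- by move=> x y z /newB[Bx By Bz]; split; exact: fieldB.
- by move=> x y [z /newB[Bx _ _]] [z' /newB[By _ _]]; exact: new_tot.
- by move=> _ n; apply: fieldB; left.
Qed.

Definition injects (X W : Type) := exists f : X -> W, injective f.

Lemma injects_prod (W X Y : Type) : injects nat W ->
  injects X W -> injects Y W -> injects (X * Y) W.
Proof.
move=> [i /infinite_square[f finj]] [g ginj] [h hinj].
by exists (fun p => f (g p.1, h p.2)) => -[x y] [x' y'] /= /finj [/ginj-> /hinj->].
Qed.

Lemma injects_seq (W X : Type) : injects nat W -> injects X W -> injects (seq X) W.
Proof.
move=> [i iinj] [g ginj]; have [f finj] := infinite_square iinj.
pose h := foldr (fun x w => f (g x, w)) (i 0%N).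
(* The length is stored too, since [i 0] may itself be a value of [f]. *)
exists (fun s => f (i (size s), h s)) => s s' /finj [/iinj + ].
by elim: s s' => [|x s IH] [|x' s'] //= [/IH{}IH] /finj [/ginj-> /IH->].
Qed.

(* |P| < |W|, in the form in which it is used: the image of P under pr cannot
   exhaust the W candidates g w. *)
Definition small (W X : Type) (P : set X) :=
  forall (Y : Type) (pr : X -> Y) (g : W -> Y), injective g ->
    exists w, forall x, P x -> pr x <> g w.

(* Tasks are processed along an initial ordinal, so that fewer than |W|
   choices have been made whenever a new one is required. *)
Lemma transfinite_greedy (W Task X : Type) (agree : X -> X -> Prop)
    (sat : Task -> X -> Prop) :
    injects Task W ->
    (forall x y, agree x y -> agree y x) ->
    (forall (task : Task) (P : set X), small W P ->
      (forall x, P x -> exists task', sat task' x) ->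
      (exists2 x, P x & sat task x) \/
      (exists2 x, sat task x & forall y, P y -> agree x y -> x = y)) ->
  exists Q : set X,
    [/\ forall x, Q x -> exists task, sat task x,
        forall x y, Q x -> Q y -> agree x y -> x = y
      & forall task, exists2 x, Q x & sat task x].
Proof.
move=> [code codeinj] agreeC greedy.
have [lt [wflt lt_total lt_small]] := initial_well_order W.
(* Specification of the choice [o] made at stage [w] after the choices [P]: it respects [P], and it
   completes the task coded by [w], if any. [None] means that nothing is added. *)
pose done w (P : set X) (o : option X) :=
  (forall x, o = Some x -> (exists task, sat task x) /\
    forall y, P y -> agree x y -> x = y) /\
  (forall task, code task = w -> small W P ->
    (forall x, P x -> exists task', sat task' x) ->
    exists2 x, P x \/ o = Some x & sat task x).
have /choice[G GP] (wP : W * set X) : exists o, done wP.1 wP.2 o.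
  case: wP => w P /=.
  have [[task [<- sP sat_P nP]]|no_task] := pselect (exists task, [/\ code task = w,
      small W P, forall x, P x -> exists task', sat task' x
      & ~ exists2 x, P x & sat task x]).
    have [//|[x satx xP]] := greedy task P sP sat_P.
    exists (Some x); split=> [_ [<-]|task' /codeinj -> _ _].
      by split=> //; exists task.
    by exists x => //; right.
  exists None; split=> // task taskw sP sat_P.
  have [[x Px satx]|nP] := EM (exists2 x, P x & sat task x).
    by exists x => //; left.
  by case: no_task; exists task.
pose step w (rec : forall v, lt v w -> option X) :=
  G (w, [set x | exists v (h : lt v w), rec v h = Some x]).
pose F := Fix wflt (fun=> option X) step.
pose before w := [set x | exists2 v, lt v w & F v = Some x].
have FE w : F w = G (w, before w).
  rewrite /F Fix_eq => [|v f g fg]; last first.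
    by congr step; apply: functional_extensionality_dep => u;
       apply: functional_extensionality_dep.
  congr (G (w, _)); apply/seteqP; split=> x.
    by move=> [v [h Fx]]; exists v.
  by move=> [v h Fx]; exists v, h.
have Fdone w : done w (before w) (F w) by rewrite FE; exact: (GP (w, before w)).
(* If earlier choices hit every candidate [g a], sending [a] to the stage that hits it would embed
   [W] below [w]. *)
have before_small w : small W (before w).
  move=> Y pr g ginj; apply: contrapT => /forallNP nw.
  have /choice[v vP] a : exists v, lt v w /\ exists2 x, F v = Some x & pr x = g a.
    have /existsNP[x /not_implyP[[v vw Fv] /contrapT prx]] := nw a.
    by exists v; split=> //; exists x.
  have [|a] := lt_small w v; last by case: (vP a).
  move=> a b vab; have [_ [x Fx xa]] := vP a; have [_ [y + yb]] := vP b.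
  by rewrite -vab Fx => -[xy]; apply: ginj; rewrite -xa -yb xy.
exists [set x | exists w, F w = Some x]; split.
- by move=> x [w /(proj1 (Fdone w))[]].
- move=> x y [w Fw] [v Fv] xy; have [e|/lt_total[wv|vw]] := EM (w = v).
  + by move: Fw; rewrite e Fv => -[].
  + by apply/esym; apply: (proj2 (proj1 (Fdone v) _ Fv)); [exists w|exact: agreeC].
  + by apply: (proj2 (proj1 (Fdone w) _ Fw)) => //; exists v.
- move=> task.
  have [||x] := proj2 (Fdone (code task)) task erefl.
  + exact: before_small.
  + by move=> x [v _ /(proj1 (Fdone v))[]].
  + by move=> [[v _ Fv]|Fx] satx; exists x => //; [exists v|exists (code task)].
Qed.

(** A set of triples (source, target, colour) in which no two distinct elements agree twice is a
    partial Latin colouring. *)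
Definition agree_twice (A B C : Type) (x y : A * B * C) :=
  [\/ x.1.1 = y.1.1 /\ x.1.2 = y.1.2, x.1.1 = y.1.1 /\ x.2 = y.2
    | x.1.2 = y.1.2 /\ x.2 = y.2].

(** * Colouring connected components in infinite degree *)

Section InfiniteDegree.
Variables (T W : Type) (S : T -> T -> Prop) (out inn : T -> W -> T).
Hypothesis W_infinite : injects nat W.
Hypothesis out_inj : forall s, injective (out s).
Hypothesis inn_inj : forall t, injective (inn t).
Hypothesis outP : forall s t, S s t <-> exists w, out s w = t.
Hypothesis innP : forall s t, S s t <-> exists w, inn t w = s.

(** A walk is coded by a list of directions and edge indices. Vertices of a component are named by
    such codes, and the codes embed into [W]. *)
Let step x (e : bool * W) := if e.1 then out x e.2 else inn x e.2.

Let walk := foldl step.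

Let conn x y := exists p, walk x p = y.

Let conn_refl x : conn x x.
Proof. by exists [::]. Qed.

Let conn_trans y x z : conn x y -> conn y z -> conn x z.
Proof. by move=> [p <-] [q <-]; exists (p ++ q); rewrite /walk foldl_cat. Qed.

Let conn_edge s t : S s t -> conn s t /\ conn t s.
Proof.
move=> Sst; split.
  by have [w wt] := (outP s t).1 Sst; exists [:: (true, w)].
by have [w ws] := (innP s t).1 Sst; exists [:: (false, w)].
Qed.

Let conn_sym x y : conn x y -> conn y x.
Proof.
move=> [p <-]; elim: p x => [|[b w] p IH] x; first exact: conn_refl.
apply: conn_trans (IH _) _; rewrite /step; case: b => /=.
  by apply: (proj2 (conn_edge _)); apply/outP; exists w.
by apply: (proj1 (conn_edge _)); apply/innP; exists w.
Qed.

Let component_coloring r : exists Q : set (T * T * W),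
  [/\ forall x, Q x -> S x.1.1 x.1.2 /\ conn r x.1.1,
      forall x y, Q x -> Q y -> agree_twice x y -> x = y
    & [/\ forall s t, conn r s -> S s t -> exists c, Q (s, t, c),
          forall s c, conn r s -> exists t, Q (s, t, c)
        & forall t c, conn r t -> exists s, Q (s, t, c)]].
Proof.
(* At the vertex reached by the walk, [None] asks for a colour on the outgoing edge of the given
   index, [Some true] for an outgoing edge of the given colour, [Some false] for an incoming one. *)
pose sat (task : seq (bool * W) * (option bool * W)) (x : T * T * W) :=
  S x.1.1 x.1.2 /\ match task.2.1 with
    | None => x.1.1 = walk r task.1 /\ x.1.2 = out x.1.1 task.2.2
    | Some true => x.1.1 = walk r task.1 /\ x.2 = task.2.2
    | Some false => x.1.2 = walk r task.1 /\ x.2 = task.2.2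
    end.
have [||task P Psmall Psat|Q [Qsat Qagree Qtask]] :=
    @transfinite_greedy W _ _ (@agree_twice T T W) sat.
- have [i iinj] := W_infinite.
  have cnt (X : countType) : injects X W.
    by exists (i \o pickle); exact: inj_comp iinj (pcan_inj pickleK).
  have WW : injects W W by exists id.
  by apply: injects_prod => //; [apply: injects_seq|]; rewrite //; exact: injects_prod.
- by move=> x y [] [e e']; [apply: Or31|apply: Or32|apply: Or33].
- have [[x Px satx]|nP] := EM (exists2 x, P x & sat task x); [by left; exists x|right].
  have PS x : P x -> S x.1.1 x.1.2 by move=> /Psat[task' []].
  case: task nP => p [[[]|] w] nP.
  + have [a aP] := Psmall _ (fun x => x.1.2) _ (@out_inj (walk r p)).
    exists (walk r p, out (walk r p) a, w).
      by split=> //=; apply/outP; exists a.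
    move=> y Py [] [] /= e e'.
    * by case: (aP y Py).
    * by case: nP; exists y => //; split; [exact: PS|].
    * by case: (aP y Py).
  + have [a aP] := Psmall _ (fun x => x.1.1) _ (@inn_inj (walk r p)).
    exists (inn (walk r p) a, walk r p, w).
      by split=> //=; apply/innP; exists a.
    move=> y Py [] [] /= e e'.
    * by case: (aP y Py).
    * by case: (aP y Py).
    * by case: nP; exists y => //; split; [exact: PS|].
  + have [a aP] := Psmall _ (fun x => x.2) id (@inj_id W).
    exists (walk r p, out (walk r p) w, a).
      by split=> //=; apply/outP; exists w.
    move=> y Py [] [] /= e e'.
    * by case: nP; exists y => //; split; [exact: PS|rewrite /= -e -e'].
    * by case: (aP y Py).
    * by case: (aP y Py).
exists Q; split=> //.
- move=> x /Qsat[[p [o w]] [Sx /= xP]]; split=> //.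
  case: o xP => [[]|] [e _].
  + by rewrite e; exists p.
  + by apply: conn_trans (conn_edge Sx).2; rewrite e; exists p.
  + by rewrite e; exists p.
- split.
  + move=> _ t [p <-] /outP[w <-].
    have [[[s' t'] c] Qx [_ /= [<- <-]]] := Qtask (p, (None, w)).
    by exists c.
  + move=> _ c [p <-].
    have [[[s' t'] c'] Qx [_ /= [<- <-]]] := Qtask (p, (Some true, c)).
    by exists t'.
  + move=> _ c [p <-].
    have [[[s' t'] c'] Qx [_ /= [<- <-]]] := Qtask (p, (Some false, c)).
    by exists s'.
Qed.

Lemma latin_of_infinite_indexing : exists P : T -> T -> W -> Prop, latin S P.
Proof.
have [[x0 _]|T0] := pselect (exists x : T, True); last first.
  by exists (fun _ _ _ => False); split=> // s; case: T0; exists s.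
(* Choosing from sets makes [rep x] depend only on the component of [x]. *)
have /choice[g gP] (A : set T) : exists x, A !=set0 -> A x.
  have [[x Ax]|nA] := pselect (A !=set0); first by exists x.
  by exists x0 => /nA.
pose rep x := g (conn x).
have rep_conn x : conn (rep x) x.
  by apply: conn_sym; apply: (gP (conn x)); exists x.
have rep_edge s t : S s t -> rep s = rep t.
  move=> /conn_edge[st ts]; congr g; apply/seteqP; split=> x.
    exact: conn_trans ts.
  exact: conn_trans st.
have /choice[Q QP] := component_coloring.
exists (fun s t c => Q (rep s) (s, t, c)); split.
- by move=> s t c; have [QS _ _] := QP (rep s) => /QS[].
- move=> s t Sst; have [_ Qagree [Qc _ _]] := QP (rep s).
  have [c Qstc] := Qc s t (rep_conn s) Sst.
  exists c; split=> // c' Qc'.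
  by have [] := Qagree _ _ Qstc Qc' (Or31 _ _ (conj erefl erefl)).
- move=> s c; have [_ Qagree [_ Qt _]] := QP (rep s).
  have [t Qstc] := Qt s c (rep_conn s).
  exists t; split=> // t' Qt'.
  by have [] := Qagree _ _ Qstc Qt' (Or32 _ _ (conj erefl erefl)).
- move=> t c; have [QS Qagree [_ _ Qs]] := QP (rep t).
  have [s Qstc] := Qs t c (rep_conn t).
  have [/= Sst _] := QS _ Qstc.
  exists s; split=> [|s' Qs']; first by rewrite (rep_edge _ _ Sst).
  have [QS' _ _] := QP (rep s'); have [/= Sst' _] := QS' _ Qs'.
  rewrite (rep_edge _ _ Sst') in Qs'.
  by have [] := Qagree _ _ Qstc Qs' (Or33 _ _ (conj erefl erefl)).
Qed.

End InfiniteDegree.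

Lemma latin_infinite (T W : Type) (S : T -> T -> Prop) :
  injects nat W -> biregular W S -> exists P : T -> T -> W -> Prop, latin S P.
Proof.
move=> W_inf [/choice[out outP] /choice[inn innP]].
apply: (@latin_of_infinite_indexing _ _ _ out inn W_inf) => x.
- exact: (outP x).1.
- exact: (innP x).1.
- exact: (outP x).2.
- by move=> t; exact: (innP t).2.
Qed.

(** * From colourings to quasigroups, and back *)

Lemma card_eq_enum (T U : Type) (A : set T) (B : set U) : (A #= B)%card ->
  exists f : A -> U, injective f /\ forall u, B u <-> exists a, f a = u.
Proof.
move=> /card_bijP[f [g fg gf]]; exists (val \o f); split.
  by apply: inj_comp (can_inj fg); exact: val_inj.
move=> u; split=> [Bu|[a <-]]; last exact: set_valP.
by exists (g (SigSub (mem_set Bu))); rewrite /= gf.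
Qed.

Lemma out_indexed_bij (T W W' : Type) (S : T -> T -> Prop) (h : W' -> W) :
    injective h -> (forall w, exists w', h w' = w) ->
  out_indexed W S -> out_indexed W' S.
Proof.
move=> hinj hsurj Sout s; have [f [finj fP]] := Sout s.
exists (f \o h); split=> [|t]; first exact: inj_comp.
rewrite fP; split=> [[w <-]|[w' <-]]; last by exists (h w').
by have [w' <-] := hsurj w; exists w'.
Qed.

Lemma latin_of_biregular (T W : Type) (S : T -> T -> Prop) : biregular W S ->
  exists (C : Type) (P : T -> T -> C -> Prop), latin S P.
Proof.
move=> Sreg; have [[n]|] := EM (finite_set [set: W]).
  rewrite card_eq_sym (card_eql card_II) => /card_eq_enum[h [hinj hP]].
  pose h' (i : 'I_n) := h (SigSub (mem_set I : i \in [set: 'I_n])).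
  have h'inj : injective h' by move=> i j /hinj[].
  have h'surj w : exists i, h' i = w.
    have [a <-] := (hP w).1 I; exists (val a); congr h; exact: val_inj.
  exists 'I_n; apply: latin_finite; case: Sreg => Sout Sin.
  by split; apply: out_indexed_bij h'inj h'surj _.
move=> /infiniteP/card_leP[f]; exists W; apply: latin_infinite Sreg.
exists (fun n => val (f (SigSub (mem_set I : n \in [set: nat])))).
by move=> m n /val_inj /(@inj _ _ _ f _ _ (mem_set I) (mem_set I)) [].
Qed.

Lemma latin_sum (T C1 C2 : Type) (S S1 S2 : T -> T -> Prop)
    (P1 : T -> T -> C1 -> Prop) (P2 : T -> T -> C2 -> Prop) :
    (forall s t, S s t <-> S1 s t \/ S2 s t) ->
    (forall s t, S1 s t -> S2 s t -> False) ->
    latin S1 P1 -> latin S2 P2 ->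
  latin S (fun s t c => match c with inl c => P1 s t c | inr c => P2 s t c end).
Proof.
move=> SU SI [PS1 Pc1 Pt1 Ps1] [PS2 Pc2 Pt2 Ps2]; split.
- by move=> s t [c /PS1|c /PS2] Sst; apply/SU; [left|right].
- move=> s t /SU[Sst|Sst].
    have [c [Pc cu]] := Pc1 s t Sst; exists (inl c); split=> // -[c' /cu->//|c' /PS2].
    by move=> /(SI _ _ Sst).
  have [c [Pc cu]] := Pc2 s t Sst; exists (inr c); split=> // -[c' /PS1|c' /cu->//].
  by move=> Sst'; case: (SI _ _ Sst' Sst).
- by move=> s [c|c].
- by move=> t [c|c].
Qed.

Lemma latin_diagonal (T : Type) :
  latin (fun s t : T => s = t) (fun s t (_ : unit) => s = t).
Proof.
split=> //.
- by move=> s t st; exists tt; split=> // -[].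
- by move=> s _; exists s.
- by move=> t _; exists t; split=> // s ->.
Qed.

(** The index [w1] of [s] among its own successors varies with [s], but the new index type must not:
    [h] frees [w0] by moving its value to [w1]. *)
Lemma out_indexed_off_diagonal (T W : Type) (S : T -> T -> Prop) (w0 : W) :
    (forall s, S s s) -> out_indexed W S ->
  out_indexed {w | w <> w0} (fun s t => S s t /\ s <> t).
Proof.
move=> Sdiag Sout s; have [f [finj fP]] := Sout s.
have [w1 fw1] := (fP s).1 (Sdiag s).
have Sf w : S s (f w) by apply/fP; exists w.
pose h (w : {w | w <> w0}) :=
  if pselect (proj1_sig w = w1) then f w0 else f (proj1_sig w).
exists h; split.
  move=> [w ww0] [w' ww0']; rewrite /h /=.
  case: pselect => ww1; case: pselect => ww1' /finj ww.
  - by apply: eq_exist; rewrite ww1 ww1'.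
  - by case: ww0'.
  - by case: ww0.
  - exact: eq_exist.
move=> t; split=> [[/fP[w ft] st]|[[w ww0] <-]]; last first.
  rewrite /h /=; case: pselect => ww1 /=; split=> //.
    by rewrite -{1}fw1 => /finj ww0'; apply: ww0; rewrite ww1.
  by rewrite -{1}fw1 => /finj /esym.
have [ww0|ww0] := EM (w = w0).
  have w10 : w1 <> w0 by move=> w10; apply: st; rewrite -fw1 -ft ww0 w10.
  by exists (exist _ w1 w10); rewrite /h /=; case: pselect => //= _; rewrite -ww0.
exists (exist _ w ww0); rewrite /h /=; case: pselect => //= ww1.
by case: st; rewrite -fw1 -ft ww1.
Qed.

Lemma biregular_off_diagonal (T W : Type) (S : T -> T -> Prop) (w0 : W) :
    (forall s, S s s) -> biregular W S ->
  biregular {w | w <> w0} (fun s t => S s t /\ s <> t).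
Proof.
move=> Sdiag [Sout Sin]; split; first exact: out_indexed_off_diagonal.
move=> t; have [f [finj fP]] := out_indexed_off_diagonal w0 Sdiag Sin t.
exists f; split=> // s; rewrite -fP; split=> -[Sst st]; split=> // e; exact: st.
Qed.

(** [P] is a Latin square with colours as entries; renaming each colour [c] by the [q] with
    [P r q c] makes row [r] the identity. *)
Lemma latin_quasigroup (T C : Type) (P : T -> T -> C -> Prop) (r : T) :
    latin (fun _ _ => True) P ->
  exists op : T -> T -> T, [/\ quasigroup op, left_identity op r,
    forall p q c, P r q c -> P p (op p q) c
    & (exists c, forall p, P p p c) -> right_identity op r].
Proof.
move=> [_ Pc Pt Ps].
have cuniq s t c c' : P s t c -> P s t c' -> c = c'.
  by have [d [_ du]] := Pc s t I => /du <- /du <-.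
have tuniq s t t' c : P s t c -> P s t' c -> t = t'.
  by have [d [_ du]] := Pt s c => /du <- /du <-.
have suniq s s' t c : P s t c -> P s' t c -> s = s'.
  by have [d [_ du]] := Ps t c => /du <- /du <-.
have /choice[op pairP] (pq : T * T) :
    exists t, forall c, P r pq.2 c -> P pq.1 t c.
  have [c [Pqc _]] := Pc r pq.2 I; have [t [Pt' _]] := Pt pq.1 c.
  by exists t => c' /(cuniq _ _ _ _ Pqc) <-.
have opP p q c : P r q c -> P p (op (p, q)) c by exact: (pairP (p, q)).
exists (fun p q => op (p, q)); split=> //.
- split=> p q.
    have [c [Pqc _]] := Pc p q I; have [x [Px _]] := Pt r c.
    exists x; split=> [|y pyq]; first exact: tuniq (opP _ _ _ Px) Pqc.
    have [d [Pd _]] := Pc r y I.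
    have Pqd := opP p _ _ Pd; rewrite pyq in Pqd.
    by apply: (tuniq _ _ _ _ Px); rewrite (cuniq _ _ _ _ Pqc Pqd).
  have [c [Prp _]] := Pc r p I; have [x [Px _]] := Ps q c.
  exists x; split=> [|y ypq]; first exact: tuniq (opP _ _ _ Prp) Px.
  by have := opP y _ _ Prp; rewrite ypq; exact: suniq.
- by move=> p; have [c [Prp _]] := Pc r p I; exact: tuniq (opP _ _ _ Prp) Prp.
- by move=> [c Pcc] p; exact: tuniq (opP p _ _ (Pcc r)) (Pcc p).
Qed.

(** * Labels and colours of non-edges assembled into a quasigroup *)

Section GraphToQuasigroup.
Variables (V A : Type) (G : set (V * A * V)).
Hypothesis G_simple : simple G.
Hypothesis G_det : deterministic G.
Hypothesis G_codet : codeterministic G.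
Hypothesis G_src : source_complete G.
Hypothesis G_tgt : target_complete G.

Let T : Type := set_type (vertices G).
Let L : Type := set_type (labels G).

Let adj (s t : T) := edge G (val s) (val t).

Let step (s t : T) (c : L) := G (val s, val c, val t).

Let vertex s a t : G (s, a, t) -> exists s' t' : T, exists c : L,
  [/\ val s' = s, val t' = t & val c = a].
Proof.
move=> Gst.
have vs : vertices G s by exists a, t; left.
have vt : vertices G t by exists a, s; right.
have la : labels G a by exists s, t.
by exists (SigSub (mem_set vs)), (SigSub (mem_set vt)), (SigSub (mem_set la)).
Qed.

(** Simplicity gives one label per edge; determinism with source-completeness makes each label a
    map, and the dual conditions make it bijective. *)
Let latin_step : latin adj step.
Proof.
split.
- by move=> s t c; exists (val c).
- move=> s t [a /[dup] Gst /vertex[s' [t' [c [_ _ ca]]]]]; exists c.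
  split=> [|c' Gc']; first by rewrite /step ca.
  by apply: val_inj; apply: G_simple Gc'; rewrite ca.
- move=> s c; have [t Gst] := G_src (set_valP s) (set_valP c).
  have [_ [t' [_ [_ tt' _]]]] := vertex Gst; exists t'.
  split=> [|t'' Gt'']; first by rewrite /step tt'.
  by apply: val_inj; apply: G_det Gt''; rewrite tt'.
- move=> t c; have [s Gst] := G_tgt (set_valP t) (set_valP c).
  have [s' [_ [_ [ss' _ _]]]] := vertex Gst; exists s'.
  split=> [|s'' Gs'']; first by rewrite /step ss'.
  by apply: val_inj; apply: G_codet Gs''; rewrite ss'.
Qed.

Lemma cayley_of_latin (r : T) (C : Type) (P : T -> T -> C -> Prop) :
    latin (fun s t : T => ~ edge G (val s) (val t)) P ->
  exists op : T -> T -> T,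
    [/\ quasigroup op, left_identity op r, gen_cayley_graph_of op G
      & (exists a, forall p : T, G (val p, a, val p)) \/
        (exists c, forall p, P p p c) -> right_identity op r].
Proof.
move=> latinP.
have latin_all := @latin_sum T L C (fun _ _ => True) _ _ _ _ _ _ latin_step latinP.
have [||op [op_qg op_left opP op_right]] := latin_quasigroup r (latin_all _ _).
- by move=> s t; split=> // _; exact: EM.
- by move=> s t.
exists op; split=> //.
  have /choice[lab labP] (q : set_type [set q : T | adj r q]) :
      exists a, G (val r, a, val (val q)).
    by have [a] := set_valP q; exists a.
  (* The generators are the successors of [r], each bearing the label of its edge from [r];
     determinism makes [lab] injective. *)
  exists [set q : T | adj r q], lab; split.
    move=> q q' qq; apply: val_inj; apply: val_inj.
    by apply: G_det (labP q'); rewrite -qq; exact: labP.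
  have op_lab p q : G (val p, lab q, val (op p (val q))).
    have [_ [_ [c [_ _ ca]]]] := vertex (labP q).
    by rewrite -ca; apply: (opP p (val q) (inl c)); rewrite /step ca.
  apply/seteqP; split=> [[[s a] t] Gst|_ [p [q ->]]]; last exact: op_lab.
  have [s' [_ [c [ss' _ ca]]]] := vertex Gst.
  (* The generator for the label [a] is the target of the edge labelled [a] leaving [r]. *)
  have [q [/= Gq _]] := (let: And4 _ _ h _ := latin_step in h) r c.
  have rq : [set q : T | adj r q] q by exists (val c).
  pose q' : set_type [set q : T | adj r q] := SigSub (mem_set rq).
  have labq : lab q' = a by rewrite -ca; exact: G_simple (labP q') Gq.
  exists s', q'; rewrite ss' labq; congr pair.
  by apply: G_det Gst _; rewrite -ss' -labq; exact: op_lab.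
move=> loops; apply: op_right; case: loops => [[a Ga]|[c Pc]].
  have [_ [_ [c [_ _ ca]]]] := vertex (Ga r).
  by exists (inl c) => p; rewrite /step ca.
by exists (inr c).
Qed.

Lemma biregular_nonedges : coregular G ->
  exists W : Type, biregular W (fun s t : T => ~ edge G (val s) (val t)).
Proof.
move=> [U [D [_ Dcard]]]; exists D.
have lift (X : set V) (S' : T -> Prop) : (X #= D)%card ->
    (forall v, X v <-> exists2 t : T, S' t & val t = v) ->
    exists f : D -> T, injective f /\ forall t, S' t <-> exists w, f w = t.
  rewrite card_eq_sym => /card_eq_enum[f [finj fP]] XS.
  have /choice[g gP] w : exists t : T, S' t /\ val t = f w.
    by have [|t] := (XS (f w)).1; [apply/fP; exists w|exists t].
  exists g; split=> [w w' ww|t].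
    by apply: finj; rewrite -(gP w).2 -(gP w').2 ww.
  split=> [St|[w <-]]; last exact: (gP w).1.
  have [w wt] : exists w, f w = val t by apply/fP/XS; exists t.
  by exists w; apply: val_inj; rewrite (gP w).2.
split=> s; have [sD sD'] := Dcard _ (set_valP s).
  apply: lift sD _ => v; rewrite /xsection /= inE; split=> [[_ /= vv nE]|].
    by exists (SigSub (mem_set vv)).
  by move=> [t nE <-]; split=> //=; exact: set_valP.
apply: lift sD' _ => v; rewrite /ysection /= inE; split=> [[/= vv _ nE]|].
  by exists (SigSub (mem_set vv)).
by move=> [t nE <-]; split=> //=; exact: set_valP.
Qed.

End GraphToQuasigroup.

(** * Properties of Cayley graphs of quasigroups *)

Section QuasigroupToGraph.
Variables (V A : Type) (G : set (V * A * V)) (M : set V) (op : M -> M -> M).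
Hypothesis G_nonempty : G !=set0.
Hypothesis op_quasigroup : quasigroup op.
Hypothesis G_cayley : gen_cayley_graph_of op G.

Let op_injr p : injective (op p).
Proof.
move=> q q' qq; have [x [_ xu]] := op_quasigroup.1 p (op p q').
by rewrite -(xu q qq) -(xu q' erefl).
Qed.

Let op_injl q : injective (op^~ q).
Proof.
move=> p p' pp; have [x [_ xu]] := op_quasigroup.2 q (op p' q).
by rewrite -(xu p pp) -(xu p' erefl).
Qed.

(** Since [G] has an edge, [Q] has an element, and multiplying by it gives an edge out of every
    point of [M]. *)
Let vertices_eq : vertices G = M.
Proof.
have [Q [lab [labinj GE]]] := G_cayley; have [e0 G0] := G_nonempty.
apply/seteqP; split=> [v [a [w]]|v Mv].
  by rewrite GE => -[[p [q [-> _ _]]]|[p [q [_ _ ->]]]]; exact: set_valP.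
rewrite GE in G0; have [_ [q _]] := G0; pose p : M := SigSub (mem_set Mv).
by exists (lab q), (val (op p (val q))); left; rewrite GE; exists p, q.
Qed.

(** The non-successors of [p] are the products [op p q] with [q] outside [Q], and the
    non-predecessors of [t] are the quotients of [t] by such [q]. Both families are indexed
    injectively by the complement of [Q]. *)
Lemma quasigroup_graph_coregular : coregular G.
Proof.
have [Q [lab [labinj GE]]] := G_cayley.
have edgeE (p t : M) : edge G (val p) (val t) <-> exists2 q, Q q & op p q = t.
  split=> [[a]|[q Qq <-]].
    rewrite GE => -[p' [q [/val_inj -> _ /val_inj ->]]].
    by exists (val q) => //; exact: set_valP.
  pose q' : Q := SigSub (mem_set Qq).
  by exists (lab q'); rewrite GE; exists p, q'.
(* [d (t, q)] is the quotient of [t] by [q] on the right. *)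
have /choice[d dP] (tq : M * M) : exists s, op s tq.2 = tq.1.
  by have [s [? _]] := op_quasigroup.2 tq.2 tq.1; exists s.
have card_out (p : M) : (xsection (nonedges G) (val p) #= ~` Q)%card.
  suff -> : xsection (nonedges G) (val p) = (val \o op p) @` (~` Q).
    apply: inj_card_eq; apply: in2W; exact: inj_comp val_inj (@op_injr p).
  apply/seteqP; split=> v; rewrite /xsection /= inE.
    move=> [/= _ vv nE]; rewrite vertices_eq in vv.
    have [q [pq _]] := op_quasigroup.1 p (SigSub (mem_set vv)).
    exists q; last by rewrite /= pq.
    by move=> Qq; apply: nE; apply/(edgeE p (SigSub (mem_set vv))); exists q.
  move=> [q nQ <-]; split; rewrite /= ?vertices_eq; try exact: set_valP.
  by move=> /edgeE[q' Qq' /op_injr qq]; apply: nQ; rewrite -qq.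
have card_in (t : M) : (ysection (nonedges G) (val t) #= ~` Q)%card.
  suff -> : ysection (nonedges G) (val t) = (fun q => val (d (t, q))) @` (~` Q).
    apply: inj_card_eq; apply: in2W => q q' /val_inj dd.
    by apply: (@op_injr (d (t, q))); rewrite {2}dd (dP (t, q)) (dP (t, q')).
  apply/seteqP; split=> v; rewrite /ysection /= inE.
    move=> [/= vv _ nE]; rewrite vertices_eq in vv.
    pose p : M := SigSub (mem_set vv).
    have [q [pq _]] := op_quasigroup.1 p t.
    exists q; last by rewrite -[v]/(val p); congr (val _); apply: (@op_injl q);
      rewrite (dP (t, q)).
    by move=> Qq; apply: nE; apply/(edgeE p); exists q.
  move=> [q nQ <-]; split; rewrite /= ?vertices_eq; try exact: set_valP.
  move=> /edgeE[q' Qq']; rewrite -[RHS](dP (t, q)) /= => /op_injr qq.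
  by apply: nQ; rewrite -qq.
have card_vertex v : vertices G v ->
    (xsection (nonedges G) v #= ~` Q)%card /\ (ysection (nonedges G) v #= ~` Q)%card.
  rewrite vertices_eq => Mv; pose p : M := SigSub (mem_set Mv).
  by split; [exact: (card_out p)|exact: (card_in p)].
exists M, (~` Q); split=> //; split.
  by move=> _ [] [v /card_vertex[x y] <-]; [move: x|move: y];
    rewrite card_eq_le => /andP[].
(* The bound is least because it is attained at the vertex [s]. *)
have [[[s a] t] G0] := G_nonempty; have vs : vertices G s by exists a, t; left.
move=> W E EP; have [cs _] := card_vertex s vs.
by rewrite -(card_le_eql cs); apply: EP; left; exists s.
Qed.

Lemma quasigroup_graph_properties :
  simple G /\ deterministic G /\ codeterministic G /\ coregular G /\
  source_complete G /\ target_complete G.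
Proof.
have [Q [lab [labinj GE]]] := G_cayley.
do ![split]; rewrite ?vertices_eq.
- move=> s a b t; rewrite GE => -[p [q [-> -> ->]]] [p' [q' [/val_inj <- ->]]].
  by move=> /val_inj /op_injr /val_inj ->.
- move=> s a t t'; rewrite GE => -[p [q [-> -> ->]]] [p' [q' [/val_inj <-]]].
  by move=> /labinj <- ->.
- move=> t a s s'; rewrite GE => -[p [q [-> -> ->]]] [p' [q' [-> /labinj <-]]].
  by move=> /val_inj /op_injl ->.
- exact: quasigroup_graph_coregular.
- move=> s a; rewrite vertices_eq => Ms [s1 [t1]]; rewrite GE => -[p1 [q [_ -> _]]].
  pose p : M := SigSub (mem_set Ms).
  by exists (val (op p (val q))); exists p, q.
- move=> t a; rewrite vertices_eq => Mt [s1 [t1]]; rewrite GE => -[p1 [q [_ -> _]]].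
  pose t' : M := SigSub (mem_set Mt).
  have [p [pq _]] := op_quasigroup.2 (val q) t'.
  by exists (val p); exists p, q; rewrite pq.
Qed.

(** A loop at [p] labelled by [q] means [op p q = p = op p e], so [q] is [e] by cancellation, and
    [e] gives a loop everywhere. *)
Lemma right_identity_loop_complete e : right_identity op e -> loop_complete G.
Proof.
have [Q [lab [labinj GE]]] := G_cayley.
move=> pe a [v]; rewrite GE => -[p [q [-> -> /val_inj pq]]] w.
rewrite -GE vertices_eq => Mw; rewrite GE; pose w' : M := SigSub (mem_set Mw).
have w'q : op w' (val q) = w'.
  by rewrite -[RHS]pe; congr op; apply: (@op_injr p); rewrite -pq pe.
by exists w', q; rewrite w'q.
Qed.

End QuasigroupToGraph.

(** * The two equivalences *)

Lemma latin_of_coregular (V A : Type) (G : set (V * A * V)) : coregular G ->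
  exists (C : Type) (P : vertices G -> vertices G -> C -> Prop),
    latin (fun s t => ~ edge G (val s) (val t)) P.
Proof. by move=> /biregular_nonedges[W /latin_of_biregular]. Qed.

Lemma latin_with_diagonal (T W : Type) (S : T -> T -> Prop) :
    biregular W S -> (forall s, S s s) ->
  exists (C : Type) (P : T -> T -> C -> Prop),
    latin S P /\ exists c, forall s, P s s c.
Proof.
move=> Sreg Sdiag; have [[s0 _]|T0] := EM (exists s : T, True); last first.
  exists unit, (fun _ _ _ => False); split; last by exists tt => s; case: T0; exists s.
  by split=> // s; case: T0; exists s.
have [f [_ fP]] := Sreg.1 s0; have [w0 _] := (fP s0).1 (Sdiag s0).
have [C [P latinP]] := latin_of_biregular (biregular_off_diagonal w0 Sdiag Sreg).
exists (C + unit)%type, (fun s t c => match c with inl c => P s t c | inr _ => s = t end).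
split; last by exists (inr tt).
apply: latin_sum latinP (latin_diagonal T) => s t; last by move=> [].
split=> [Sst|[[]//|<-//]].
by have [|] := EM (s = t); [right|left].
Qed.

Theorem theorem7p8 (V A : Type) (G : set (V * A * V)) (G_nonempty : G !=set0) :
  [<->
    (exists (M : set V) (op : M -> M -> M),
       quasigroup op /\ gen_cayley_graph_of op G);
    (exists (M : set V) (op : M -> M -> M),
       [/\ quasigroup op, exists e, left_identity op e
         & gen_cayley_graph_of op G]);
    (simple G /\ deterministic G /\ codeterministic G /\ coregular G /\
     source_complete G /\ target_complete G)]
  /\
  [<->
    (exists (M : set V) (op : M -> M -> M),
       [/\ quasigroup op, exists e, right_identity op e
         & gen_cayley_graph_of op G]);
    (exists (M : set V) (op : M -> M -> M),
       [/\ quasigroup op, exists e, identity op e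
         & gen_cayley_graph_of op G]);
    (simple G /\ deterministic G /\ codeterministic G /\ coregular G /\
     source_complete G /\ target_complete G /\ loop_complete G)].
Proof.
have [[[s0 a0] t0] G0] := G_nonempty.
have vs0 : vertices G s0 by exists a0, t0; left.
pose r : vertices G := SigSub (mem_set vs0).
split.
  (* Proved before the cycle because (a) implies (b) passes through (c). *)
  have c_b : simple G /\ deterministic G /\ codeterministic G /\ coregular G /\
      source_complete G /\ target_complete G ->
    exists (M : set V) (op : M -> M -> M),
      [/\ quasigroup op, exists e, left_identity op e & gen_cayley_graph_of op G].
    move=> [simG [detG [codG [/latin_of_coregular[C [P latinP]] [srcG tgtG]]]]].
    have [op [opQ opr opG _]] := cayley_of_latin simG detG codG srcG tgtG r latinP.
    by exists (vertices G), op; split=> //; exists r.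
  tfae.
  - by move=> [M [op [opQ opG]]]; apply: c_b; exact: quasigroup_graph_properties opQ opG.
  - by move=> [M [op [opQ _ opG]]]; exact: quasigroup_graph_properties opQ opG.
  - by move=> /c_b[M [op [opQ _ opG]]]; exists M, op.
have a_c (M : set V) (op : M -> M -> M) e : quasigroup op -> right_identity op e ->
    gen_cayley_graph_of op G ->
  simple G /\ deterministic G /\ codeterministic G /\ coregular G /\
  source_complete G /\ target_complete G /\ loop_complete G.
  move=> opQ ope opG.
  have [? [? [? [? [? ?]]]]] := quasigroup_graph_properties G_nonempty opQ opG.
  by do ![split=> //]; exact: right_identity_loop_complete opQ opG _ ope.
have c_b : simple G /\ deterministic G /\ codeterministic G /\ coregular G /\
    source_complete G /\ target_complete G /\ loop_complete G ->
  exists (M : set V) (op : M -> M -> M),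
    [/\ quasigroup op, exists e, identity op e & gen_cayley_graph_of op G].
  move=> [simG [detG [codG [corG [srcG [tgtG loopG]]]]]].
  have [C [P [latinP loopP]]] : exists (C : Type)
      (P : vertices G -> vertices G -> C -> Prop),
      latin (fun s t => ~ edge G (val s) (val t)) P /\
      ((exists a, forall p : vertices G, G (val p, a, val p)) \/
       (exists c, forall p, P p p c)).
    (* Either way the diagonal is monochromatic: one loop spreads its label to all vertices, and
       without loops the diagonal consists of non-edges and gets a colour of its own. *)
    have [[a [v Gv]]|noloop] := EM (exists a v, G (v, a, v)).
      have [C [P latinP]] := latin_of_coregular corG.
      exists C, P; split=> //; left; exists a => p.
      by apply: loopG; [exists v|exact: set_valP].
    have [W Wreg] := biregular_nonedges corG.
    have [|C [P [latinP diagP]]] := latin_with_diagonal Wreg.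
      by move=> s [a Ga]; apply: noloop; exists a, (val s).
    by exists C, P; split=> //; right.
  have [op [opQ opl opG opr]] := cayley_of_latin simG detG codG srcG tgtG r latinP.
  by exists (vertices G), op; split=> //; exists r; split=> //; exact: opr.
tfae.
- by move=> [M [op [opQ [e ope] opG]]]; apply: c_b; exact: a_c opQ ope opG.
- by move=> [M [op [opQ [e [_ ope]] opG]]]; exact: a_c opQ ope opG.
- by move=> /c_b[M [op [opQ [e [_ ope]] opG]]]; exists M, op; split=> //; exists e.
Qed.
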